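(* Let $z_0=(\mathbf n_0,c_0\boldsymbol\epsilon)$ and $z_1=(\mathbf n_1,c_1\boldsymbol\epsilon)$ be points of $\mathcal T^n$ with $\mathbf n_1\neq-\mathbf n_0$, and let $\theta\in[0,\pi)$ be defined by $\cos\theta=\mathbf n_0\cdot\mathbf n_1$. Then the curve $$\gamma(t)=\lambda(t,\theta)\,z_1+\lambda(1-t,\theta)\,z_0,\qquad 0\le t\le 1,$$ is a geodesic of $\Lambda^{n+1}$, for the Lorentzian metric on $\Lambda^{n+1}$, with $\gamma(0)=z_0$ and $\gamma(1)=z_1$. Furthermore, $\gamma(t)\in\mathcal T^n$ for all $0\le t\le1$. Hence $\mathcal T^n$ is a geodesic submanifold of $\Lambda^{n+1}$, in the sense that it contains this geodesic joining any two of its points $z_0,z_1$ with $\mathbf n_1\ne-\mathbf n_0$.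
   Context: $\mathbb R^{n+2,1}$ denotes Minkowski space: $\mathbb R^{n+2}$ with the bilinear form $\langle v,w\rangle_L=\sum_{i=1}^{n+1}v_iw_i-v_{n+2}w_{n+2}$. De Sitter space is $\Lambda^{n+1}=\{v\in\mathbb R^{n+2,1}:\langle v,v\rangle_L=1\}$, with the induced Lorentzian metric (index $1$) and its Levi-Civita connection. Write $\boldsymbol\epsilon=(1,1)\in\mathbb R^2$, so $(\mathbf n,c\boldsymbol\epsilon)=(\mathbf n,c,c)\in\mathbb R^n\times\mathbb R^2$. Put $\mathcal T^n=\{(\mathbf n,c\boldsymbol\epsilon):\mathbf n\in S^{n-1}\subset\mathbb R^n,\ c\in\mathbb R\}\subset\Lambda^{n+1}$. The function $\lambda$ is $\lambda(x,\theta)=\sin(x\theta)/\sin\theta$ for $\theta\ne0$, $|\theta|<\pi$, and $\lambda(x,0)=x$. *)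

(* Defs.v *)
From HB Require Import structures.
From mathcomp Require Import all_boot all_order all_algebra.
From mathcomp Require Import all_classical all_reals all_analysis.
From mathcomp Require Import ring.

Set Implicit Arguments.
Unset Strict Implicit.
Unset Printing Implicit Defensive.
Import Order.TTheory GRing.Theory Num.Theory.
Import numFieldNormedType.Exports.

Local Open Scope classical_set_scope.
Local Open Scope ring_scope.

Section Smooth.
Context {R : realType} {U V : normedModType R}.
Implicit Types f : U -> V.

Fixpoint Ck (k : nat) f : Prop :=
  (forall x, differentiable f x) /\
  if k is k'.+1 then forall v, Ck k' ('D_v f) else True.

(* All iterated directional derivatives exist and are differentiable.  The
   spaces [U] used below are finite-dimensional, so this is C^oo. *)
Definition smooth f : Prop := forall k, Ck k f.

End Smooth.

Section DeSitter.
Context {R : realType} {n : nat}.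

Notation E := 'rV[R]_(n + 2).

Definition mink (v w : E) : R :=
  \sum_(i < n + 2 | (i <= n)%N) v 0 i * w 0 i
  - v 0 (rshift n ord_max) * w 0 (rshift n ord_max).

Definition de_sitter : set E := [set p | mink p p = 1].

(* The kernel of the differential of [p |-> mink p p] at [p]. *)
Definition tangent (p v : E) : Prop := mink p v = 0.

(* De Sitter space is closed in [E], so its smooth vector fields are exactly
   the restrictions of the smooth maps [E -> E] that are tangent along it;
   likewise for smooth functions and [E -> R].  Only the values on de Sitter
   space of such a map matter. *)
Definition vector_field (Y : E -> E) : Prop :=
  smooth Y /\ forall p, de_sitter p -> tangent p (Y p).

(* For fields tangent along de Sitter space, the ambient bracket restricts
   there to the Lie bracket of the restrictions. *)
Definition lie_bracket (X Y : E -> E) (p : E) : E :=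
  'D_(X p) Y p - 'D_(Y p) X p.

(* [nabla p v Y] stands for the covariant derivative of the field [Y] in the
   direction of the tangent vector [v] at [p]; it is constrained only when [p]
   is in de Sitter space, [v] is tangent at [p] and [Y] is a vector field. *)
Record affine_connection (nabla : E -> E -> (E -> E) -> E) : Prop := {
  connection_tangent : forall p v Y, de_sitter p -> tangent p v ->
    vector_field Y -> tangent p (nabla p v Y);
  connection_restr : forall p v Y Z, de_sitter p -> tangent p v ->
    vector_field Y -> vector_field Z ->
    (forall q, de_sitter q -> Y q = Z q) -> nabla p v Y = nabla p v Z;
  connection_smooth : forall X Y, vector_field X -> vector_field Y ->
    exists2 Z, vector_field Z &
      forall p, de_sitter p -> Z p = nabla p (X p) Y;
  connection_linear : forall p a v w Y, de_sitter p -> tangent p v ->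
    tangent p w -> vector_field Y ->
    nabla p (a *: v + w) Y = a *: nabla p v Y + nabla p w Y;
  connection_add : forall p v Y Z, de_sitter p -> tangent p v ->
    vector_field Y -> vector_field Z ->
    nabla p v (Y \+ Z) = nabla p v Y + nabla p v Z;
  connection_leibniz : forall p v (f : E -> R) Y, de_sitter p ->
    tangent p v -> smooth f -> vector_field Y ->
    nabla p v (fun q => f q *: Y q) = 'D_v f p *: Y p + f p *: nabla p v Y
}.

Record levi_civita (nabla : E -> E -> (E -> E) -> E) : Prop := {
  levi_civita_connection : affine_connection nabla;
  levi_civita_metric : forall p v Y Z, de_sitter p -> tangent p v ->
    vector_field Y -> vector_field Z ->
    'D_v (fun q => mink (Y q) (Z q)) p
    = mink (nabla p v Y) (Z p) + mink (Y p) (nabla p v Z);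
  levi_civita_torsion : forall p X Y, de_sitter p ->
    vector_field X -> vector_field Y ->
    nabla p (X p) Y - nabla p (Y p) X = lie_bracket X Y p
}.

(* [W] is the covariant derivative of the vector field [V] along the curve
   [gamma] : [0, 1] -> de Sitter space.  The derivative D/dt along [gamma] is
   characterised by additivity, the Leibniz rule and
   D(Y o gamma)/dt = nabla_(gamma') Y for vector fields [Y] on de Sitter
   space; every smooth field along [gamma] decomposes as below and the value
   does not depend on the decomposition. *)
Definition covariant_derivative (nabla : E -> E -> (E -> E) -> E)
    (gamma V W : R -> E) : Prop :=
  exists (m : nat) (f : 'I_m -> R -> R) (Y : 'I_m -> E -> E),
  [/\ forall i, smooth (f i),
      forall i, vector_field (Y i) &
      forall t : R, 0 <= t <= 1 ->
        V t = \sum_(i < m) f i t *: Y i (gamma t) /\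
        W t = \sum_(i < m) (derive1 (f i) t *: Y i (gamma t)
                            + f i t *: nabla (gamma t) (derive1 gamma t) (Y i))].

(* Curves on [0, 1] are given by smooth maps on the whole line; only their
   restriction to [0, 1] is required to lie in de Sitter space. *)
Definition geodesic (nabla : E -> E -> (E -> E) -> E) (gamma : R -> E) : Prop :=
  [/\ smooth gamma,
      forall t : R, 0 <= t <= 1 -> de_sitter (gamma t) &
      covariant_derivative nabla gamma (derive1 gamma) (cst 0)].

(* Embedded submanifold of dimension [d], as a local regular level set. *)
Definition submanifold (d : nat) (S : set E) : Prop :=
  forall p, S p -> exists (k : nat) (F : E -> 'rV[R]_k),
  [/\ (d + k = n + 2)%N,
      smooth F,
      forall w, exists v, 'D_v F p = w &
      \forall q \near p, S q <-> F q = 0].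

Definition dot (v w : 'rV[R]_n) : R := \sum_i v 0 i * w 0 i.

Definition unit_sphere : set 'rV[R]_n := [set v | dot v v = 1].

Definition calT_point (v : 'rV[R]_n) (c : R) : E := row_mx v (c *: const_mx 1).

Definition calT : set E := [set z | exists2 v, unit_sphere v & exists c, z = calT_point v c].

Definition lam (x theta : R) : R :=
  if theta == 0 then x else sin (x * theta) / sin theta.

Definition joining_curve (theta : R) (z0 z1 : E) (t : R) : E :=
  lam t theta *: z1 + lam (1 - t) theta *: z0.

(* Here [theta] is the angle between the sphere components of the endpoints,
   which exists because they are not antipodal. *)
Definition geodesic_submanifold (nabla : E -> E -> (E -> E) -> E)
    (S : set E) : Prop :=
  [/\ S `<=` de_sitter,
      submanifold n S &
      forall z0 z1, S z0 -> S z1 -> lsubmx z1 <> - lsubmx z0 ->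
      exists theta, [/\ 0 <= theta < pi,
        cos theta = dot (lsubmx z0) (lsubmx z1),
        geodesic nabla (joining_curve theta z0 z1),
        joining_curve theta z0 z1 0 = z0 /\ joining_curve theta z0 z1 1 = z1 &
        forall t : R, 0 <= t <= 1 -> S (joining_curve theta z0 z1 t)]].

End DeSitter.

Section SmoothTheory.
Context {R : realType}.

Section Gen.
Context {U V : normedModType R}.
Implicit Types f g : U -> V.

Lemma Ck_diff k f : Ck k f -> forall x, differentiable f x.
Proof. by case: k => [|k] []. Qed.

Lemma smooth_diff f : smooth f -> forall x, differentiable f x.
Proof. by move=> /(_ 0%N); apply: Ck_diff. Qed.

Lemma smooth_derive f v : smooth f -> smooth ('D_v f).
Proof. by move=> sf k; have [_] := sf k.+1; apply. Qed.

Lemma Ck_le k f : Ck k.+1 f -> Ck k f.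
Proof.
elim: k f => [|k IH] f; first by case.
by move=> [df Df]; split=> // v; apply/IH/Df.
Qed.

Lemma CkD k f g : Ck k f -> Ck k g -> Ck k (fun x => f x + g x).
Proof.
elim: k f g => [|k IH] f g [df Df] [dg Dg].
  by split=> // x; apply: differentiableD.
split; first by move=> x; apply: differentiableD.
move=> v; rewrite (_ : 'D_v _ = fun x => 'D_v f x + 'D_v g x).
  by apply: IH; [exact: Df|exact: Dg].
by apply/funext => x; apply: deriveD; apply: diff_derivable.
Qed.

Lemma Ck_cst k (c : V) : Ck k (fun _ : U => c).
Proof.
elim: k c => [|k IH] c; first by split.
split=> // v; rewrite (_ : 'D_v _ = fun x => 0) //.
by apply/funext => x; exact: derive_cst.
Qed.

Lemma Ck_sum k m (F : 'I_m -> U -> V) (P : pred 'I_m) :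
  (forall i, Ck k (F i)) -> Ck k (fun x => \sum_(i < m | P i) F i x).
Proof.
move=> CF; elim: (index_enum _) => [|i s IH].
  by rewrite (_ : (fun _ => _) = fun _ => 0); [exact: Ck_cst|apply/funext => x; rewrite big_nil].
case Pi : (P i).
  rewrite (_ : (fun _ => _) = fun x => F i x + \sum_(j <- s | P j) F j x).
    exact: CkD.
  by apply/funext => x; rewrite big_cons Pi.
rewrite (_ : (fun _ => _) = fun x => \sum_(j <- s | P j) F j x) //.
by apply/funext => x; rewrite big_cons Pi.
Qed.

Lemma Ck_lin k f : linear f -> continuous f -> Ck k f.
Proof.
move=> lf cf; pose fM := GRing.isLinear.Build _ _ _ _ f lf.
pose fL : {linear U -> V} := HB.pack f fM.
have df x : differentiable f x by exact: (@linear_differentiable _ _ _ fL).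
case: k => [|k]; first by split.
split=> // v.
rewrite (_ : 'D_v _ = fun x => f v); first exact: Ck_cst.
by apply/funext => x; rewrite deriveE// (@diff_lin _ _ _ fL).
Qed.
End Gen.

Lemma CkM k (U : normedModType R) (f g : U -> R) : Ck k f -> Ck k g ->
  Ck k (fun x => f x * g x).
Proof.
elim: k f g => [|k IH] f g Cf Cg.
  by split=> // x; apply: differentiableM; apply: Ck_diff; eassumption.
split; first by move=> x; apply: differentiableM; apply: Ck_diff; eassumption.
move=> v; rewrite (_ : 'D_v _ = fun x => f x * 'D_v g x + g x * 'D_v f x).
    by apply: CkD; apply: IH => //; try exact: Ck_le; [case: Cg => _|case: Cf => _]; apply.
  by apply/funext => x; apply: deriveM; apply: diff_derivable; apply: Ck_diff; eassumption.
Qed.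

Lemma CkZl k (U V : normedModType R) (f : U -> R) (c : V) : Ck k f ->
  Ck k (fun x => f x *: c).
Proof.
elim: k f => [|k IH] f Cf.
  by split=> // x; apply: differentiableZl; apply: Ck_diff; eassumption.
have df x : differentiable f x by exact: Ck_diff Cf x.
split; first by move=> x; apply: differentiableZl.
move=> v; rewrite (_ : 'D_v _ = fun x => 'D_v f x *: c).
  by apply: IH; case: Cf => _; apply.
apply/funext => x; rewrite deriveE; last exact: differentiableZl.
by rewrite diffZl// deriveE.
Qed.

Section Mx.
Context {U : normedModType R} {m : nat}.
Implicit Type f : U -> 'rV[R]_m.

Lemma rVE f : f = fun x => \sum_i f x 0 i *: delta_mx 0 i.
Proof. by apply/funext => x; exact: row_sum_delta. Qed.

Lemma derive_coord f v x i : differentiable f x ->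
  'D_v f x 0 i = 'D_v (fun y => f y 0 i) x.
Proof.
move=> df; rewrite derive_mx ?mxE//; exact: diff_derivable.
Qed.

Lemma diff_coord f x i : differentiable f x -> differentiable (fun y => f y 0 i) x.
Proof. move=> df; apply: (@differentiable_comp _ _ _ _ f (fun M : 'rV[R]_m => M 0 i)) => //.
exact: differentiable_coord. Qed.

Lemma Ck_coord k f i : Ck k f -> Ck k (fun x => f x 0 i).
Proof.
elim: k f => [|k IH] f [df Df].
  by split=> // x; exact: diff_coord.
split; first by move=> x; exact: diff_coord.
move=> v; rewrite (_ : 'D_v _ = fun x => 'D_v f x 0 i); first by apply: IH; exact: Df.
by apply/funext => x; rewrite derive_coord.
Qed.

Lemma Ck_rV k f : (forall i, Ck k (fun x => f x 0 i)) -> Ck k f.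
Proof. by move=> Cf; rewrite (rVE f); apply: Ck_sum => i; apply: CkZl. Qed.

Lemma CkZ k (g : U -> R) f : Ck k g -> Ck k f -> Ck k (fun x => g x *: f x).
Proof.
move=> Cg Cf; apply: Ck_rV => i.
rewrite (_ : (fun _ => _) = fun x => g x * f x 0 i).
  by apply: CkM => //; exact: Ck_coord.
by apply/funext => x; rewrite mxE.
Qed.

Lemma derive_scale (g : U -> R) f v x : smooth g -> smooth f ->
  'D_v (fun y => g y *: f y) x = 'D_v g x *: f x + g x *: 'D_v f x.
Proof.
move=> sg sf; apply/rowP => i.
rewrite derive_coord; last by apply: (Ck_diff (CkZ (sg 0%N) (sf 0%N))).
rewrite (_ : (fun _ => _) = fun y => g y * f y 0 i); last first.
  by apply/funext => y; rewrite mxE.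
have dg := @diff_derivable _ _ _ _ _ v (smooth_diff sg x).
have dfi := @diff_derivable _ _ _ _ _ v (diff_coord i (smooth_diff sf x)).
have -> := deriveM dg dfi.
rewrite !mxE derive_coord; last exact: smooth_diff.
by rewrite addrC; congr (_ + _); exact: mulrC.
Qed.
End Mx.
End SmoothTheory.

Section LeviCivitaExists.
Context {R : realType} {n : nat}.
Notation E := 'rV[R]_(n + 2).
Implicit Types u v w p : E.

Lemma minkC v w : mink v w = mink w v.
Proof.
by rewrite /mink [v 0 _ * _]mulrC; congr (_ - _); apply: eq_bigr => i _; rewrite mulrC.
Qed.

Lemma minkDl a u v w : mink (a *: u + v) w = a * mink u w + mink v w.
Proof.
rewrite /mink !mxE mulrBr mulrDl.
rewrite (_ : \sum_(i < _ | _) _ = a * (\sum_(i < n + 2 | (i <= n)%N) u 0 i * w 0 i)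
  + \sum_(i < n + 2 | (i <= n)%N) v 0 i * w 0 i); first by ring.
rewrite mulr_sumr -big_split/=; apply: eq_bigr => i _; rewrite !mxE; ring.
Qed.

Lemma minkD u v w : mink (u + v) w = mink u w + mink v w.
Proof. by rewrite -{1}[u]scale1r minkDl mul1r. Qed.
Lemma mink0 w : mink 0 w = 0.
Proof. by apply: (addIr (mink 0 w)); rewrite -minkD !add0r. Qed.
Lemma minkZ a u w : mink (a *: u) w = a * mink u w.
Proof. by rewrite -[_ *: _]addr0 minkDl mink0 addr0. Qed.
Lemma minkN u w : mink (- u) w = - mink u w.
Proof. by rewrite -scaleN1r minkZ mulN1r. Qed.

Lemma Ck_mink k (U : normedModType R) (Y Z : U -> E) : Ck k Y -> Ck k Z ->
  Ck k (fun q => mink (Y q) (Z q)).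
Proof.
move=> CY CZ; rewrite /mink.
pose l : 'I_(n + 2) := rshift n ord_max.
rewrite (_ : (fun q => _) = fun q => \sum_(i < n + 2 | (i <= n)%N) Y q 0 i * Z q 0 i
   + (Y q 0 l * Z q 0 l) * (-1)); last by apply/funext => q; rewrite mulrN1.
apply: CkD; first by apply: (@Ck_sum R U R) => i; apply: CkM; exact: Ck_coord.
by apply: CkM; [apply: CkM; exact: Ck_coord|exact: Ck_cst].
Qed.

Lemma derive_mink (U : normedModType R) (Y Z : U -> E) (v p : U) : smooth Y -> smooth Z ->
  'D_v (fun q => mink (Y q) (Z q)) p = mink ('D_v Y p) (Z p) + mink (Y p) ('D_v Z p).
Proof.
move=> sY sZ.
have dY := smooth_diff sY p; have dZ := smooth_diff sZ p.
have idM i : is_derive p v (fun q => Y q 0 i * Z q 0 i)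
    (Y p 0 i * 'D_v Z p 0 i + Z p 0 i * 'D_v Y p 0 i).
  have dYi := diff_coord i dY; have dZi := diff_coord i dZ.
  rewrite (derive_coord v i dY) (derive_coord v i dZ).
  by apply: (is_deriveM (f := fun q => Y q 0 i) (g := fun q => Z q 0 i));
    apply: derivableP; apply: diff_derivable.
have idS : is_derive p v (fun q => \sum_(i < n + 2) 
    ((i <= n)%:R *: (Y q 0 i * Z q 0 i) : R)) (\sum_(i < n + 2) 
    (i <= n)%:R *: (Y p 0 i * 'D_v Z p 0 i + Z p 0 i * 'D_v Y p 0 i)).
  have := @is_derive_sum _ _ _ _ (fun i q => ((i : 'I_(n + 2)) <= n)%:R *: (Y q 0 i * Z q 0 i) : R)
    p v _ (fun i => @is_deriveZ R U R _ (i <= n)%:R p v _ (idM i)).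
  by rewrite (_ : \sum_(i < n + 2) _ = fun q => \sum_(i < n + 2) 
    ((i <= n)%:R *: (Y q 0 i * Z q 0 i) : R))//; apply/funext => q; rewrite fct_sumE.
pose l : 'I_(n + 2) := rshift n ord_max.
have sE (F : 'I_(n + 2) -> R) : \sum_(i < n + 2 | (i <= n)%N) F i = \sum_(i < n + 2) (i <= n)%:R *: F i.
  by rewrite big_mkcond/=; apply: eq_bigr => i _; case: ifP; rewrite ?scale1r ?scale0r.
rewrite (_ : (fun q => mink _ _) = fun q => \sum_(i < n + 2) 
    ((i <= n)%:R *: (Y q 0 i * Z q 0 i) : R) - (Y q 0 l * Z q 0 l)); last first.
  by apply/funext => q; rewrite /mink sE.
have D := is_deriveB idS (idM l); rewrite (@derive_val _ _ _ _ _ _ _ D) => {D}.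
rewrite /mink !sE -/l.
rewrite (_ : \sum_i _ *: (_ + _) = \sum_(i < n + 2) (i <= n)%:R *: ('D_v Y p 0 i * Z p 0 i) +
   \sum_(i < n + 2) (i <= n)%:R *: (Y p 0 i * 'D_v Z p 0 i)); first by ring.
rewrite -big_split/=; apply: eq_bigr => i _; rewrite -scalerDr; congr (_ *: _); ring.
Qed.

Lemma smooth_id : smooth (fun q : E => q).
Proof. by move=> k; apply: Ck_lin => // x; exact: cvg_id. Qed.

(* [c] is a rational curve in de Sitter space through [p] with velocity [v]. *)
Lemma derive_tangent0 (V : normedModType R) (g : E -> V) p v : smooth g ->
  (forall q, de_sitter q -> g q = 0) -> de_sitter p -> tangent p v ->
  'D_v g p = 0.
Proof.
move=> sg g0 dp tv.
pose a := mink v v / 4.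
pose u (h : R) : R := (1 + a * h ^+ 2)^-1.
pose c (h : R) : E := u h *: ((1 - a * h ^+ 2) *: p + h *: v).
have u0 : u 0 = 1 by rewrite /u expr0n mulr0 addr0 invr1.
have c0 : c 0 = p by rewrite /c u0 expr0n mulr0 subr0 !scale1r scale0r addr0.
have cdS h : 1 + a * h ^+ 2 != 0 -> de_sitter (c h).
  move=> ne; rewrite /de_sitter /= /c minkZ minkC minkZ.
  rewrite minkDl minkZ [mink p _]minkC minkDl [mink v (_ + _)]minkC minkDl !minkZ.
  rewrite (minkC v p) tv dp (_ : mink v v = 4 * a); last by rewrite /a; field.
  by rewrite /u; field.
have q0 : 1 + a * (0 : R) ^+ 2 != 0 by rewrite expr0n mulr0 addr0 oner_eq0.
have dX : is_derive (0:R) 1 (fun h : R => h ^+ 2) 0.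
  have := @is_deriveX R R id 2 (0:R) 1 1 (is_derive_id _ _).
  rewrite (_ : _ *: _ = 0); last by rewrite /= expr1 mulr0 scale0r.
  by rewrite (_ : id ^+ 2 = fun h : R => h ^+ 2).
have dQ (b : R) : is_derive (0:R) 1 (fun h : R => 1 + b * h ^+ 2) 0.
  have := is_deriveD (is_derive_cst (1:R) (0:R) 1) (@is_deriveZ R R R _ b _ _ _ dX).
  by rewrite scaler0 addr0.
have du : is_derive (0:R) 1 u 0.
  have := @is_deriveV R (fun h : R => 1 + a * h ^+ 2) 0 0 1 q0 (dQ a).
  by rewrite scaler0.
have dA : is_derive (0:R) 1 (fun h => u h * (1 + (- a) * h ^+ 2)) 0.
  have := is_deriveM du (dQ (- a)).
  by rewrite !scaler0 addr0.
have dB : is_derive (0:R) 1 (fun h => u h * h) 1.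
  have := is_deriveM du (is_derive_id (0:R) 1).
  by rewrite u0 scaler0 addr0 scale1r.
have dc : is_derive (0:R) 1 c v.
  pose Ac := fun h => u h * (1 + (- a) * h ^+ 2); pose Bc := fun h => u h * h.
  have cE : c = (fun h => Ac h *: p) + (fun h => Bc h *: v).
    apply/funext => h; rewrite /c /Ac /Bc fctE.
    by rewrite scalerDr !scalerA mulNr.
  have dfA : differentiable Ac 0 by apply/derivable1_diffP; case: dA.
  have dfB : differentiable Bc 0 by apply/derivable1_diffP; case: dB.
  have d1 : is_derive (0:R) 1 (fun h => Ac h *: p) 0.
    have dd := differentiableZl p dfA.
    apply: DeriveDef; first exact: diff_derivable.
    by rewrite deriveE// diffZl// -deriveE// (@derive_val _ _ _ _ _ _ _ dA) scale0r.
  have d2 : is_derive (0:R) 1 (fun h => Bc h *: v) v.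
    have dd := differentiableZl v dfB.
    apply: DeriveDef; first exact: diff_derivable.
    by rewrite deriveE// diffZl// -deriveE// (@derive_val _ _ _ _ _ _ _ dB) scale1r.
  by have := is_deriveD d1 d2; rewrite add0r -cE.
have dfc : differentiable c 0 by apply/derivable1_diffP; case: dc.
have dg : differentiable g (c 0) by exact: smooth_diff.
have gc0 : 'D_1 (g \o c) 0 = 0.
  rewrite (@near_eq_derive _ _ _ _ (fun _ : R => (0 : V))) ?derive_cst//.
  have Hc : {for (0:R), continuous (fun h : R => 1 + a * h ^+ 2)}.
    by apply/differentiable_continuous/derivable1_diffP; case: (dQ a).
  have H : \forall h \near (0:R), 1 + a * h ^+ 2 != 0 by apply: (cvgr_neq0 _ Hc).
  by near=> h; apply: g0; apply: cdS; near: h.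
move: gc0; rewrite deriveE; last exact: differentiable_comp.
rewrite diff_comp//= -[X in 'd g _ X]deriveE// (@derive_val _ _ _ _ _ _ _ dc).
by rewrite c0 deriveE// -c0.
Unshelve. all: by end_near. Qed.

(* The tangential part of the ambient derivative. *)
Definition nabla0 p v (Y : E -> E) : E := 'D_v Y p - mink ('D_v Y p) p *: p.

Lemma nabla0P Y p v Z : tangent p Z -> mink (nabla0 p v Y) Z = mink ('D_v Y p) Z.
Proof. by move=> tZ; rewrite /nabla0 minkD minkN minkZ tZ mulr0 subr0. Qed.

Lemma deriveDv (U V : normedModType R) (f : U -> V) (p : U) a (v w : U) : smooth f ->
  'D_(a *: v + w) f p = a *: 'D_v f p + 'D_w f p.
Proof. by move=> sf; rewrite !deriveE ?linearP//; exact: smooth_diff. Qed.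

Lemma smooth_field_derive (X Y : E -> E) : smooth X -> smooth Y ->
  smooth (fun p => 'D_(X p) Y p).
Proof.
move=> sX sY k.
rewrite (_ : (fun p => _) = fun p => \sum_i X p 0 i *: 'D_(delta_mx 0 i) Y p).
  apply: Ck_sum => i; apply: CkZ; first exact/Ck_coord/sX.
  exact: smooth_derive.
apply/funext => p; rewrite {1}(row_sum_delta (X p)) deriveE; last exact: smooth_diff.
rewrite linear_sum; apply: eq_bigr => i _; rewrite linearZ deriveE//.
exact: smooth_diff.
Qed.

Lemma smoothD (U V : normedModType R) (f g : U -> V) : smooth f -> smooth g ->
  smooth (fun x => f x + g x).
Proof. by move=> sf sg k; apply: CkD. Qed.

(* In particular the predicate [levi_civita] is inhabited. *)
Lemma levi_civita_nabla0 : levi_civita nabla0.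
Proof.
have tg p Y v : de_sitter p -> tangent p (nabla0 p v Y).
  rewrite /de_sitter /tangent /= => dp; rewrite minkC /nabla0 minkD minkN minkZ dp.
  by rewrite mulr1 subrr.
have key p Y v : de_sitter p -> tangent p v -> vector_field Y ->
    mink ('D_v Y p) p = - mink (Y p) v.
  move=> dp tv [sY tY].
  have : 'D_v (fun q => mink (Y q) q) p = 0.
    apply: derive_tangent0 => //.
    - by move=> k; apply: Ck_mink; [exact: sY|exact: smooth_id].
    - by move=> q dq; rewrite minkC; apply: tY.
  rewrite (derive_mink (Y := Y) (Z := fun q => q))//; last exact: smooth_id.
  by rewrite derive_id => /eqP; rewrite addr_eq0 => /eqP.
split; first split.
- by move=> p v Y dp _ _; apply: tg.
- move=> p v Y Z dp tv [sY _] [sZ _] YZ; rewrite /nabla0.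
  suff -> : 'D_v Y p = 'D_v Z p by [].
  apply/eqP; rewrite -subr_eq0; apply/eqP.
  rewrite -deriveB; try by apply: diff_derivable; apply: smooth_diff.
  apply: derive_tangent0 => // [|q dq]; last by rewrite !fctE YZ// subrr.
  have -> : Y - Z = fun q => Y q + (-1) *: Z q.
    by apply/funext => q; rewrite scaleN1r.
  by apply: smoothD => // k; apply: CkZ; [exact: Ck_cst|exact: sZ].
- move=> X Y [sX tX] fY; exists (fun p => nabla0 p (X p) Y) => //; split; last first.
    by move=> p dp; apply: tg.
  have sD := smooth_field_derive sX (proj1 fY).
  apply: smoothD => // k.
  rewrite (_ : (fun x => _) = fun x => (-1 * mink ('D_(X x) Y x) x) *: x).
    apply: CkZ; last exact: smooth_id.
    apply: CkM; first exact: Ck_cst.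
    by apply: Ck_mink => //; exact: smooth_id.
  by apply/funext => q; rewrite mulN1r scaleNr.
- move=> p a v w Y dp tv tw [sY _]; rewrite /nabla0 deriveDv// minkDl scalerBr scalerA.
  by rewrite scalerDl opprD addrACA.
- move=> p v Y Z dp tv [sY _] [sZ _]; rewrite /nabla0.
  rewrite deriveD; try by apply: diff_derivable; apply: smooth_diff.
  by rewrite minkD scalerDl opprD addrACA.
- move=> p v f Y dp tv sf [sY tY]; rewrite /nabla0 derive_scale//.
  rewrite minkDl (minkC (Y p)) (tY p dp) mulr0 add0r minkZ.
  by rewrite -scalerA -addrA -scalerBr.
- move=> p v Y Z dp tv [sY tY] [sZ tZ].
  rewrite derive_mink// nabla0P; last exact: tZ.
  by congr (_ + _); rewrite !(minkC (Y p)) nabla0P//; exact: tY.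
- move=> p X Y dp fX fY; rewrite /nabla0 /lie_bracket.
  rewrite (key _ _ _ dp (proj2 fX p dp) fY) (key _ _ _ dp (proj2 fY p dp) fX).
  rewrite (minkC (Y p)); move: (- mink _ _) => m.
  by rewrite opprD addrACA subrr addr0.
Qed.

End LeviCivitaExists.

(* Main.v *)
From HB Require Import structures.
Require Import Defs.
From mathcomp Require Import all_boot all_order all_algebra.
From mathcomp Require Import all_classical all_reals all_analysis.
From mathcomp Require Import ring lra.
Import Order.TTheory GRing.Theory Num.Theory.
Import numFieldNormedType.Exports.
Local Open Scope classical_set_scope.
Local Open Scope ring_scope.

(** Since [calT_point v c] differs from [(v, 0)] by a multiple of the null vector
    orthogonal to it, [mink z0 z1 = cos theta], and the curve [gamma] stays in the
    plane of [z0] and [z1].  It is an orbit of the one-parameter group of Lorentz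
    transformations generated by the linear field
    [Y q = a (mink q z0 z1 - mink q z1 z0)], with [a = theta / sin theta]
    ([a = 1] for [theta = 0]).  For any Levi-Civita connection Koszul's formula
    gives [mink (nabla_Y Y) Z = mink (D_Y Y) Z], and [D_Y Y = Y (Y p)] is a
    multiple of [p] on the plane of [z0] and [z1], hence normal to de Sitter
    space: [nabla_Y Y] vanishes along [gamma].  Finally [calT] is the regular
    level set [mink q q = 1], [mink q null_dir = 0]. *)

(** * Euclidean and Minkowski products, and nondegeneracy *)

Section Minkowski.
Context {R : realType} {n : nat}.
Implicit Types (u v w p z : 'rV[R]_(n + 2)) (a b : 'rV[R]_n).

Lemma dotC a b : dot a b = dot b a.
Proof. by apply: eq_bigr => i _; rewrite mulrC. Qed.

Lemma dotDl a b c : dot (a + b) c = dot a c + dot b c.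
Proof. by rewrite -big_split; apply: eq_bigr => i _; rewrite mxE mulrDl. Qed.

Lemma dotZl k a b : dot (k *: a) b = k * dot a b.
Proof. by rewrite mulr_sumr; apply: eq_bigr => i _; rewrite mxE mulrA. Qed.

Lemma dotvv_ge0 a : 0 <= dot a a.
Proof. by apply: sumr_ge0 => i _; rewrite -expr2 sqr_ge0. Qed.

Lemma dotvv_eq0 a : dot a a = 0 -> a = 0.
Proof.
move=> a0; apply/rowP => i; rewrite mxE; apply/eqP.
have /psumr_eq0P : forall j, true -> 0 <= a 0 j * a 0 j.
  by move=> j _; rewrite -expr2 sqr_ge0.
by move=> /(_ a0 i isT)/eqP; rewrite mulf_eq0 orbb.
Qed.

Lemma dot_unitD a b : unit_sphere a -> unit_sphere b ->
  dot (a + b) (a + b) = 2 * (1 + dot a b).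
Proof.
rewrite /unit_sphere/= => ua ub.
by rewrite dotDl !(dotC _ (a + b)) !dotDl ua ub (dotC b a); ring.
Qed.

Lemma dot_unit_ge a b : unit_sphere a -> unit_sphere b -> -1 <= dot a b.
Proof.
by move=> ua ub; have := dotvv_ge0 (a + b); rewrite dot_unitD//; lra.
Qed.

Lemma dot_unit_le a b : unit_sphere a -> unit_sphere b -> dot a b <= 1.
Proof.
move=> ua ub; rewrite -lerN2 -[leRHS]mulN1r -dotZl; apply: dot_unit_ge => //.
by rewrite /unit_sphere/= dotZl dotC dotZl ua; ring.
Qed.

(** In the equality case [dot_unitD] makes the squared length of [a + b] vanish, so [a] and [b] are
    antipodal. *)
Lemma dot_unit_gt a b : unit_sphere a -> unit_sphere b -> b <> - a ->
  -1 < dot a b.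
Proof.
move=> ua ub ba; rewrite lt_neqAle dot_unit_ge// andbT; apply/eqP => ab.
apply: ba; apply/eqP; rewrite -addr_eq0; apply/eqP/dotvv_eq0.
by rewrite addrC dot_unitD// -ab; ring.
Qed.

Lemma mink_row_mx a b (s t : 'rV[R]_2) :
  mink (row_mx a s) (row_mx b t) = dot a b + s 0 0 * t 0 0 - s 0 1 * t 0 1.
Proof.
rewrite /mink !row_mxEr big_mkcond big_split_ord/= big_ord_recr big_ord1/=.
rewrite addn0 leqnn ifF; last by rewrite addn1 ltnn.
rewrite addr0 !row_mxEr; congr (_ + _ * _ - _ * _).
- by apply: eq_bigr => i _; rewrite ltnW ?row_mxEl.
all: by congr (_ _ _); apply/val_inj.
Qed.

Lemma mink_calT_point a b c d :
  mink (calT_point a c) (calT_point b d) = dot a b.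
Proof. by rewrite mink_row_mx !mxE; ring. Qed.

Lemma mink_nondegenerate u : (forall v, mink u v = 0) -> u = 0.
Proof.
rewrite -[u]hsubmxK; move: (lsubmx u) (rsubmx u) => a s u0.
have /dotvv_eq0 a0 : dot a a = 0.
  by have := u0 (row_mx a 0); rewrite mink_row_mx !mxE !mulr0 subr0 addr0.
rewrite a0; suff -> : s = 0 by rewrite row_mx0.
(* Reversing the time component turns the Lorentzian pairing into the sum of squares of [s 0 0] and
   [s 0 1]. *)
have := u0 (row_mx a (\row_i (if i == 0 then s 0 0 else - s 0 1))).
rewrite mink_row_mx a0 -(scale0r 0) dotZl mul0r add0r !mxE/= mulrN opprK => /eqP; rewrite paddr_eq0 -?expr2 ?sqr_ge0//.
rewrite !expf_eq0/= => /andP[/eqP s0 /eqP s1].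
by apply/rowP => i; rewrite [RHS]mxE; case: i => -[|[|//]] ?; [rewrite -[RHS]s0|rewrite -[RHS]s1];
  congr (s _ _); apply/val_inj.
Qed.
End Minkowski.

(** * Integral curves of plane rotation fields as geodesics *)

Section Geodesics.
Context {R : realType} {n : nat}.
Notation E := 'rV[R]_(n + 2).
Implicit Types (v w z : E).

Lemma smooth_mink (U : normedModType R) (Y Z : U -> E) : smooth Y -> smooth Z ->
  smooth (fun q => mink (Y q) (Z q)).
Proof. by move=> sY sZ k; apply: Ck_mink. Qed.

Lemma smooth_cst (U V : normedModType R) (c : V) : smooth (fun _ : U => c).
Proof. by move=> k; apply: Ck_cst. Qed.

Lemma smoothZ (U : normedModType R) (g : U -> R) (Y : U -> E) :
  smooth g -> smooth Y -> smooth (fun q => g q *: Y q).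
Proof. by move=> sg sY k; apply: CkZ. Qed.

Lemma smoothM (U : normedModType R) (g h : U -> R) :
  smooth g -> smooth h -> smooth (fun q => g q * h q).
Proof. by move=> sg sh k; apply: CkM. Qed.

(* On de Sitter space this is the tangential projection of [w]. *)
Definition tangent_field w q : E := w + (- mink w q) *: q.

Lemma vector_field_tangent_field w : vector_field (tangent_field w).
Proof.
split=> [|p dp]; last first.
  by rewrite /tangent /tangent_field minkC minkD minkZ dp mulr1 subrr.
apply: smoothD; first exact: smooth_cst.
apply: smoothZ; last exact: smooth_id.
rewrite (_ : (fun q => _) = fun q => -1 * mink w q); last first.
  by apply/funext => q; rewrite mulN1r.
apply: smoothM; first exact: smooth_cst.
by apply: smooth_mink; [exact: smooth_cst|exact: smooth_id].
Qed.

(* Koszul's formula with both arguments equal to [Y]. *)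
Lemma levi_civita_self nabla p (Y Z : E -> E) :
  levi_civita nabla -> de_sitter p -> vector_field Y -> vector_field Z ->
  mink (nabla p (Y p) Y) (Z p) = mink ('D_(Y p) Y p) (Z p).
Proof.
move=> [_ metric torsion] dp fY fZ.
have [[sY tY] [sZ tZ]] := (fY, fZ).
(* Differentiating [mink Y Y] along [Z] shows that [nabla_Z Y] and [D_Z Y] pair equally with [Y].
   Vanishing torsion, paired with [Y], carries this over to [nabla_Y Z] and [D_Y Z], and the
   derivative of [mink Y Z] along [Y] then gives the claim. *)
have := metric p (Y p) Y Z dp (tY p dp) fY fZ.
have := metric p (Z p) Y Y dp (tZ p dp) fY fY.
rewrite !derive_mink// [mink (Y p) (nabla _ _ Y)]minkC [mink (Y p) ('D__ Y p)]minkC.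
have := congr1 (fun u => mink u (Y p)) (torsion p Y Z dp fY fZ).
rewrite /lie_bracket !minkD !minkN => e1 e2 e3.
rewrite ![mink (Y p) _]minkC in e3.
lra.
Qed.

(** The vector [nabla p (Y p) Y] is tangent, so it pairs with any [w] as with the tangential
    projection of [w]. That pairing is zero because [k *: p] is normal, and nondegeneracy of the
    ambient form concludes. *)
Lemma levi_civita_autoparallel nabla p (Y : E -> E) k :
  levi_civita nabla -> de_sitter p -> vector_field Y ->
  'D_(Y p) Y p = k *: p -> nabla p (Y p) Y = 0.
Proof.
move=> lc dp fY Yp; apply: mink_nondegenerate => w.
have fW := vector_field_tangent_field w.
have tN : tangent p (nabla p (Y p) Y).
  by apply: (connection_tangent (levi_civita_connection lc)) => //; apply: fY.2.
have := levi_civita_self nabla p Y (tangent_field w) lc dp fY fW.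
rewrite Yp minkZ fW.2// mulr0 /tangent_field minkC minkD minkZ tN mulr0 addr0.
by rewrite minkC.
Qed.

(* An element of the Lie algebra of the isometry group of [mink]. *)
Definition plane_field a z0 z1 q : E :=
  (a * mink q z0) *: z1 + (- a * mink q z1) *: z0.

Lemma Ck_plane_field k a z0 z1 (U : normedModType R) (Y : U -> E) :
  Ck k Y -> Ck k (fun q => plane_field a z0 z1 (Y q)).
Proof.
move=> CY; apply: CkD; apply: CkZ; try exact: Ck_cst;
  apply: CkM; try exact: Ck_cst; apply: Ck_mink => //; exact: Ck_cst.
Qed.

Lemma smooth_plane_field a z0 z1 : smooth (plane_field a z0 z1).
Proof. by move=> k; apply: Ck_plane_field; exact: smooth_id. Qed.

Lemma vector_field_plane_field a z0 z1 : vector_field (plane_field a z0 z1).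
Proof.
split=> [|p _]; first exact: smooth_plane_field.
by rewrite /tangent minkC /plane_field minkD !minkZ ![mink _ p]minkC; ring.
Qed.

Lemma derive_plane_field a z0 z1 v p :
  'D_v (plane_field a z0 z1) p = plane_field a z0 z1 v.
Proof.
have lin : linear (plane_field a z0 z1).
  move=> k x y; rewrite /plane_field !minkDl.
  move: (mink x z0) (mink y z0) (mink x z1) (mink y z1) => x0 y0 x1 y1.
  by apply/rowP => i; rewrite !mxE; ring.
pose f : {linear E -> E} :=
  HB.pack (plane_field a z0 z1) (GRing.isLinear.Build _ _ _ _ _ lin).
have df x := smooth_diff (smooth_plane_field a z0 z1) x.
rewrite deriveE// (diff_lin (f := f))// => x.
exact: differentiable_continuous.
Qed.

(** On the span of [z0] and [z1] the field has a traceless 2 by 2 matrix of determinant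
    [a ^+ 2 * (1 - mink z0 z1 ^+ 2)]; by Cayley-Hamilton its square is minus this scalar. *)
Lemma plane_fieldK a z0 z1 l0 l1 : de_sitter z0 -> de_sitter z1 ->
  let p := l1 *: z1 + l0 *: z0 in
  plane_field a z0 z1 (plane_field a z0 z1 p) =
  (- a ^+ 2 * (1 - mink z0 z1 ^+ 2)) *: p.
Proof.
rewrite /de_sitter/= => d0 d1.
rewrite /plane_field !(minkD, minkZ) (minkC z1 z0) d0 d1.
move: (mink z0 z1) => c; apply/rowP => i; rewrite !mxE; ring.
Qed.

(** Bootstrapping: the derivative is a smooth function of [g] itself, so each order of
    differentiability yields the next. *)
Lemma smooth_integral_curve a z0 z1 (g : R -> E) :
  (forall t : R, is_derive t 1 g (plane_field a z0 z1 (g t))) -> smooth g.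
Proof.
move=> dg.
have df t : differentiable g t by apply/derivable1_diffP; case: (dg t).
elim=> [|k IH]; split=> // v.
rewrite (_ : 'D_v g = fun t => v *: plane_field a z0 z1 (g t)).
  by apply: CkZ; [exact: Ck_cst|exact: Ck_plane_field].
apply/funext => t; rewrite deriveE// -[v in LHS]mulr1 linearZ/= -deriveE//.
by rewrite (@derive_val _ _ _ _ _ _ _ (dg t)).
Qed.

Lemma integral_curve_geodesic nabla a z0 z1 (l0 l1 : R -> R) :
  levi_civita nabla -> de_sitter z0 -> de_sitter z1 ->
  let g t := l1 t *: z1 + l0 t *: z0 in
  (forall t : R, is_derive t 1 g (plane_field a z0 z1 (g t))) ->
  (forall t, 0 <= t <= 1 -> de_sitter (g t)) ->
  geodesic nabla g.
Proof.
move=> lc d0 d1 g dg gd.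
have g' t : g^`()%classic t = plane_field a z0 z1 (g t).
  by rewrite derive1E (@derive_val _ _ _ _ _ _ _ (dg t)).
split=> //; first exact: smooth_integral_curve dg.
(* The velocity is the restriction of one global field to the curve, so a single term with
   coefficient 1 decomposes it. *)
exists 1%N, (fun _ _ => 1), (fun _ => plane_field a z0 z1); split.
- by move=> _; exact: smooth_cst.
- by move=> _; exact: vector_field_plane_field.
- move=> t t01; rewrite !big_ord1 !scale1r derive1_cst scale0r add0r g'.
  split=> //; apply/esym/levi_civita_autoparallel => //.
  + exact: gd.
  + exact: vector_field_plane_field.
  + by rewrite derive_plane_field; exact: plane_fieldK.
Qed.
End Geodesics.

(** * Trigonometry of [lam] and the joining curve *)

Section JoiningCurve.
Context {R : realType}.
Implicit Types (t theta : R).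

Lemma sin_neq0 theta : 0 <= theta < pi -> theta != 0 -> sin theta != 0.
Proof.
move=> /andP[t0 tpi] tn0; apply/lt0r_neq0/sin_gt0_pi.
by rewrite lt_neqAle eq_sym tn0 t0.
Qed.

Lemma lam0 theta : lam 0 theta = 0.
Proof. by rewrite /lam; case: ifP => // _; rewrite mul0r sin0 mul0r. Qed.

Lemma lam1 theta : 0 <= theta < pi -> lam 1 theta = 1.
Proof.
move=> th; rewrite /lam; case: ifPn => // t0.
by rewrite mul1r divff// sin_neq0.
Qed.

Lemma sin_1B t theta : sin ((1 - t) * theta) =
  sin theta * cos (t * theta) - cos theta * sin (t * theta).
Proof. by rewrite mulrBl mul1r sinB. Qed.

(** The left side is the squared length of [lam t theta *: n1 + lam (1 - t) theta *: n0] for unit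
    vectors at angle [theta]: spherical interpolation stays on the sphere. *)
Lemma lam_unit t theta : 0 <= theta < pi ->
  lam t theta ^+ 2 + lam (1 - t) theta ^+ 2
  + 2 * lam t theta * lam (1 - t) theta * cos theta = 1.
Proof.
move=> th; rewrite /lam; case: ifPn => [/eqP->|/(sin_neq0 _ th) S0].
  by rewrite cos0; ring.
rewrite sin_1B.
have e1 := cos2Dsin2 theta; have e2 := cos2Dsin2 (t * theta).
move: (sin theta) (cos theta) (sin (t * _)) (cos (t * _)) S0 e1 e2 => S C s c S0 e1 e2.
(* Over the common denominator the terms in [s * c] cancel; the Pythagorean identities for [theta]
   and [t * theta] finish. *)
have -> : (s / S) ^+ 2 + ((S * c - C * s) / S) ^+ 2
    + 2 * (s / S) * ((S * c - C * s) / S) * C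
  = (s ^+ 2 * (1 - C ^+ 2) + S ^+ 2 * c ^+ 2) / S ^+ 2 by field.
rewrite (_ : 1 - C ^+ 2 = S ^+ 2); last by rewrite -e1; ring.
rewrite mulrC [s ^+ 2 * _]mulrC -mulrDr [s ^+ 2 + _]addrC e2 mulr1 mulVf//.
by rewrite expf_neq0.
Qed.

(** The factor [a] for which the joining curve integrates [plane_field a z0 z1]; its value at 0 is
    the limit of the quotient. *)
Definition angular_speed theta := if theta == 0 then 1 else theta / sin theta.

(** The derivative [theta * cos (t * theta) / sin theta] is expressed through [lam] by [sin_1B], in
    order to match the coefficient of [z1] in [plane_field] along the curve. *)
Lemma is_derive_lam t theta : 0 <= theta < pi ->
  is_derive t 1 (fun s => lam s theta)
    (angular_speed theta * (lam t theta * cos theta + lam (1 - t) theta)).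
Proof.
move=> th; rewrite /lam /angular_speed; case: ifPn => [/eqP->|/(sin_neq0 _ th) S0].
  rewrite cos0 (_ : 1 * _ = 1); last by ring.
  exact: is_derive_id.
have dm : is_derive t 1 (fun s : R => s * theta) theta.
  have := @is_deriveZ _ _ _ _ theta _ _ _ (is_derive_id t 1).
  rewrite (_ : theta \*: id = fun s => s * theta); last first.
    by apply/funext => s; exact: mulrC.
  by rewrite [_ *: _]mulr1.
have := @is_deriveZ _ _ _ _ (sin theta)^-1 _ _ _
  (is_derive1_comp (g := fun s => s * theta) (is_derive_sin (t * theta)) dm).
rewrite (_ : _ \*: _ = fun s => sin (s * theta) / sin theta); last first.
  by apply/funext => s; exact: mulrC.
move=> /is_derive_eq; apply; rewrite sin_1B [LHS]mulrA.
by field.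
Qed.

Lemma is_derive_lam1B t theta : 0 <= theta < pi ->
  is_derive t 1 (fun s => lam (1 - s) theta)
    (- angular_speed theta * (lam t theta + lam (1 - t) theta * cos theta)).
Proof.
move=> th; have d1 : is_derive t 1 (fun s : R => 1 - s) (-1).
  by have := is_deriveB (is_derive_cst (1 : R) t 1) (is_derive_id t 1); rewrite sub0r.
have := is_derive1_comp (g := fun s => 1 - s) (is_derive_lam (1 - t) theta th) d1.
by rewrite subKr mulrN1 addrC mulNr.
Qed.

Lemma is_derive_scale_cst (V : normedModType R) (l : R -> R) t d (z : V) :
  is_derive t 1 l d -> is_derive t 1 (fun s => l s *: z) (d *: z).
Proof.
move=> dl; have dfl : differentiable l t by apply/derivable1_diffP; case: dl.
have dd := differentiableZl z dfl.
apply: DeriveDef; first exact: diff_derivable.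
by rewrite deriveE// diffZl// -deriveE// (@derive_val _ _ _ _ _ _ _ dl).
Qed.

Lemma is_derive_joining_curve n (z0 z1 : 'rV[R]_(n + 2)) theta t :
  de_sitter z0 -> de_sitter z1 -> 0 <= theta < pi ->
  cos theta = mink z0 z1 ->
  is_derive t 1 (joining_curve theta z0 z1)
    (plane_field (angular_speed theta) z0 z1 (joining_curve theta z0 z1 t)).
Proof.
rewrite /de_sitter/= => d0 d1 th ct.
have := is_deriveD (is_derive_scale_cst _ _ _ _ z1 (is_derive_lam t theta th))
  (is_derive_scale_cst _ _ _ _ z0 (is_derive_lam1B t theta th)).
by rewrite /joining_curve /plane_field !(minkD, minkZ) (minkC z1) d0 d1 !mulr1 ct.
Qed.

Lemma joining_curve0 n (z0 z1 : 'rV[R]_(n + 2)) theta :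
  0 <= theta < pi -> joining_curve theta z0 z1 0 = z0.
Proof.
by move=> th; rewrite /joining_curve lam0 subr0 lam1// scale0r add0r scale1r.
Qed.

Lemma joining_curve1 n (z0 z1 : 'rV[R]_(n + 2)) theta :
  0 <= theta < pi -> joining_curve theta z0 z1 1 = z1.
Proof.
by move=> th; rewrite /joining_curve subrr lam0 lam1// scale0r addr0 scale1r.
Qed.

Lemma calT_de_sitter n : calT `<=` @de_sitter R n.
Proof. by move=> _ [v uv [c ->]]; rewrite /de_sitter/= mink_calT_point. Qed.

Lemma joining_curve_calT n (n0 n1 : 'rV[R]_n) c0 c1 theta t :
  unit_sphere n0 -> unit_sphere n1 -> 0 <= theta < pi ->
  cos theta = dot n0 n1 ->
  calT (joining_curve theta (calT_point n0 c0) (calT_point n1 c1) t).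
Proof.
rewrite /unit_sphere/= => u0 u1 th ct.
exists (lam t theta *: n1 + lam (1 - t) theta *: n0).
  rewrite /unit_sphere/= dotDl !dotZl !(dotC _ (_ + _)) !dotDl !dotZl.
  by rewrite (dotC n1 n0) u0 u1 -ct -[RHS](lam_unit t theta th); ring.
exists (lam t theta * c1 + lam (1 - t) theta * c0).
by rewrite /joining_curve /calT_point !scale_row_mx add_row_mx !scalerA -scalerDl.
Qed.

Lemma joining_curve_geodesic n nabla (n0 n1 : 'rV[R]_n) c0 c1 theta :
  levi_civita nabla ->
  unit_sphere n0 -> unit_sphere n1 -> 0 <= theta < pi ->
  cos theta = dot n0 n1 ->
  geodesic nabla (joining_curve theta (calT_point n0 c0) (calT_point n1 c1)).
Proof.
move=> lc u0 u1 th ct.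
have d0 : de_sitter (calT_point n0 c0) by apply: calT_de_sitter; exists n0 => //; exists c0.
have d1 : de_sitter (calT_point n1 c1) by apply: calT_de_sitter; exists n1 => //; exists c1.
apply: (integral_curve_geodesic _ (angular_speed theta)) => // t.
  by apply: is_derive_joining_curve => //; rewrite mink_calT_point.
by move=> _; apply/calT_de_sitter/joining_curve_calT.
Qed.

(** Non-antipodality keeps the product above -1, hence its arccosine below [pi]. *)
Lemma angle_exists n (n0 n1 : 'rV[R]_n) :
  unit_sphere n0 -> unit_sphere n1 -> n1 <> - n0 ->
  exists2 theta, 0 <= theta < pi & cos theta = dot n0 n1.
Proof.
move=> u0 u1 n01; have gt := dot_unit_gt _ _ u0 u1 n01.
have le := dot_unit_le _ _ u0 u1.
exists (acos (dot n0 n1)).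
  by rewrite acos_ge0 ?acos_ltpi ?gt ?(ltW gt).
by rewrite acosK// in_itv/= le ltW.
Qed.
End JoiningCurve.

(** * [calT] as a regular level set of codimension 2 *)

Section Submanifold.
Context {R : realType} {n : nat}.
Notation E := 'rV[R]_(n + 2).

(** The light-like vector (0, 1, 1), whose orthogonal hyperplane is where the last two coordinates
    agree. *)
Definition null_dir : E := calT_point 0 1.

Lemma mink_null_dir (q : E) :
  mink q null_dir = rsubmx q 0 0 - rsubmx q 0 1.
Proof.
rewrite -{1}[q]hsubmxK; move: (lsubmx q) (rsubmx q) => a s.
by rewrite mink_row_mx dotC -(scale0r 0) dotZl !mxE; ring.
Qed.

Definition calT_eqns (q : E) : 'rV[R]_2 :=
  \row_i (if i == 0 then mink q q - 1 else mink q null_dir).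

Lemma calT_eqnsP (q : E) : calT q <-> calT_eqns q = 0.
Proof.
split=> [[v uv [c ->]]|/rowP q0].
  apply/rowP => i; rewrite !mxE; case: ifP => _; rewrite mink_calT_point.
    by rewrite uv subrr.
  by rewrite dotC -(scale0r 0) dotZl mul0r.
have := q0 1; rewrite !mxE/= mink_null_dir => /eqP; rewrite subr_eq0 => /eqP s01.
have qE : q = calT_point (lsubmx q) (rsubmx q 0 0).
  rewrite -[LHS]hsubmxK; congr row_mx.
  move: (rsubmx q) s01 => s s01; apply/rowP => i; rewrite !mxE mulr1.
  by case: i => -[|[|//]] ?; [|rewrite [RHS]s01]; congr (s _ _); apply/val_inj.
exists (lsubmx q); last by exists (rsubmx q 0 0).
have := q0 0; rewrite !mxE/= {1 2}qE mink_calT_point => /eqP.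
by rewrite subr_eq0 => /eqP.
Qed.

Lemma smooth_calT_eqns : smooth calT_eqns.
Proof.
move=> k; apply: Ck_rV => -[[|i] lti].
  rewrite (_ : (fun q => _) = fun q : E => mink q q + -1).
    apply: CkD; last exact: Ck_cst.
    by apply: Ck_mink; exact: smooth_id.
  by apply/funext => q; rewrite mxE.
rewrite (_ : (fun q => _) = fun q : E => mink q null_dir).
  by apply: Ck_mink; [exact: smooth_id|exact: Ck_cst].
by apply/funext => q; rewrite mxE.
Qed.

Lemma derive_calT_eqns (v p : E) :
  'D_v calT_eqns p = \row_i (if i == 0 then 2 * mink p v else mink v null_dir).
Proof.
have sid := @smooth_id R n.
apply/rowP => i; rewrite derive_coord; last exact: smooth_diff smooth_calT_eqns p.
rewrite mxE; case: ifPn => i0.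
  rewrite (_ : (fun q => _) = (fun q : E => mink q q) - cst 1); last first.
    by apply/funext => q; rewrite mxE i0.
  rewrite deriveB; last 2 first.
  - exact: diff_derivable (smooth_diff (smooth_mink _ _ _ sid sid) p).
  - exact: derivable_cst.
  rewrite derive_cst subr0 (derive_mink _ _ sid sid) derive_id (minkC v).
  by rewrite mulr2n mulrDl mul1r.
rewrite (_ : (fun q => _) = fun q : E => mink q null_dir); last first.
  by apply/funext => q; rewrite mxE (negPf i0).
rewrite (derive_mink _ _ sid (smooth_cst _ _ null_dir)) derive_id derive_cst.
by rewrite (minkC p) mink0 addr0.
Qed.

Lemma submanifold_calT : submanifold n (calT : set E).
Proof.
move=> p Sp; exists 2%N, calT_eqns; split => //.
- exact: smooth_calT_eqns.
- move=> w; pose u : E := row_mx 0 (delta_mx 0 0).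
  have uN : mink u null_dir = 1 by rewrite mink_null_dir row_mxKr !mxE/= subr0.
  have [pp pN] : mink p p = 1 /\ mink p null_dir = 0.
    move/calT_eqnsP/rowP: Sp => Sp; split; last by have := Sp 1; rewrite !mxE.
    by apply/eqP; rewrite -subr_eq0; apply/eqP; have := Sp 0; rewrite !mxE.
  (* On [p] and [u] the differential is triangular, as [p] is orthogonal to [null_dir]: the second
     equation fixes the coefficient of [u], the first then that of [p]. *)
  exists ((w 0 0 / 2 - w 0 1 * mink p u) *: p + w 0 1 *: u).
  rewrite derive_calT_eqns; apply/rowP => i; rewrite mxE minkC !minkD !minkZ.
  rewrite (minkC u p) pp pN uN.
  have -> : 2 * ((w 0 0 / 2 - w 0 1 * mink p u) * 1 + w 0 1 * mink p u) = w 0 0.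
    by field.
  rewrite mulr0 mulr1 add0r.
  by case: i => -[|[|//]] ?; congr (w _ _); apply/val_inj.
- by near=> q; exact: calT_eqnsP.
Unshelve. all: by end_near.
Qed.
End Submanifold.

Theorem proposition4p1 (R : realType) (n : nat)
    (nabla : 'rV[R]_(n + 2) -> 'rV[R]_(n + 2) ->
             ('rV[R]_(n + 2) -> 'rV[R]_(n + 2)) -> 'rV[R]_(n + 2))
    (nabla_levi_civita : levi_civita nabla) :
  (forall (n0 n1 : 'rV[R]_n) (c0 c1 theta : R),
     unit_sphere n0 -> unit_sphere n1 -> n1 <> - n0 ->
     0 <= theta < pi -> cos theta = dot n0 n1 ->
     let z0 := calT_point n0 c0 in
     let z1 := calT_point n1 c1 in
     let gamma := fun t : R => lam t theta *: z1 + lam (1 - t) theta *: z0 in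
     [/\ geodesic nabla gamma,
         gamma 0 = z0,
         gamma 1 = z1 &
         forall t : R, 0 <= t <= 1 -> calT (gamma t)])
  /\ geodesic_submanifold nabla calT.
Proof.
split=> [n0 n1 c0 c1 theta u0 u1 _ th ct z0 z1 gamma|].
  split.
  - exact: joining_curve_geodesic.
  - exact: joining_curve0.
  - exact: joining_curve1.
  - by move=> t _; exact: joining_curve_calT.
split; [exact: calT_de_sitter|exact: submanifold_calT|].
move=> _ _ [n0 u0 [c0 ->]] [n1 u1 [c1 ->]]; rewrite !row_mxKl => n01.
have [theta th ct] := angle_exists _ _ _ u0 u1 n01.
exists theta; split=> //.
- exact: joining_curve_geodesic.
- by split; [exact: joining_curve0|exact: joining_curve1].
- by move=> t _; exact: joining_curve_calT.
Qed.
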